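(* Let $n,k,r$ be integers with $r\ge 2$, $k\ge 1$ and $n\ge rk$, and let $\mathcal{P}=\{P_1,\dots,P_l\}$ be a partition of $[n]=\{1,\dots,n\}$ such that $|P_i|\le r$ for all $1\le i\le l$. Then $$\chi(\mathrm{KG}^r(n,k,\mathcal{P}))=\left\lceil \frac{n-r(k-1)}{r-1}\right\rceil .$$
   Context: For a partition $\mathcal{P}=\{P_1,\dots,P_l\}$ of $[n]$, $\mathrm{KG}^r(n,k,\mathcal{P})$ is the $r$-uniform hypergraph whose vertices are the $k$-subsets $A\subseteq[n]$ with $|A\cap P_j|\le 1$ for all $j=1,\dots,l$, and whose edges are the $r$-element sets $\{A_1,\dots,A_r\}$ of vertices that are pairwise disjoint. The chromatic number $\chi$ of a hypergraph is the least number of colors in a coloring of the vertices with no monochromatic edge. *)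

(* Defs.v *)
From mathcomp Require Import all_boot.
Set Implicit Arguments. Unset Strict Implicit. Unset Printing Implicit Defensive.

Definition kg_vertex (n k : nat) (P : {set {set 'I_n}}) (A : {set 'I_n}) : bool :=
  (#|A| == k) && [forall B in P, #|A :&: B| <= 1].

Definition kg_edge (n k r : nat) (P : {set {set 'I_n}}) (E : {set {set 'I_n}}) : bool :=
  [&& #|E| == r,
      [forall A in E, kg_vertex k P A] &
      [forall A in E, forall A' in E, (A != A') ==> [disjoint A & A']]].

Definition kg_proper_coloring (n k r : nat) (P : {set {set 'I_n}}) (m : nat)
    (c : {set 'I_n} -> nat) : Prop :=
  (forall A, kg_vertex k P A -> c A < m) /\
  (forall E, kg_edge k r P E ->
     ~ (exists i, forall A, A \in E -> c A = i)).

Definition kg_colorable (n k r : nat) (P : {set {set 'I_n}}) (m : nat) : Prop :=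
  exists c : {set 'I_n} -> nat, kg_proper_coloring k r P m c.

Definition is_chromatic_number (n k r : nat) (P : {set {set 'I_n}}) (m : nat) : Prop :=
  kg_colorable k r P m /\ forall m', kg_colorable k r P m' -> m <= m'.

Definition ceil_div (a b : nat) : nat := (a + b - 1) %/ b.

(* Main.v *)
Require Import Defs.
From mathcomp Require Import all_boot.
From mathcomp Require Import all_algebra ring zify.
Set Implicit Arguments. Unset Strict Implicit. Unset Printing Implicit Defensive.
Import GRing.Theory.

(* The upper bound colors A by the block of r - 1 consecutive integers containing
   min A, all sets avoiding the first m - 1 blocks getting the last color.

   The lower bound n <= r(k-1) + (r-1)m for an m-coloring is multiplicative in r:
   for r = qp, refine the parts into parts of size at most p, and color each
   transversal set of size q(k-1) + (q-1)m + 1 by the color of a monochromatic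
   family of q disjoint vertices inside it.

   For r = p prime it follows from a Z/p-Tucker lemma on sign vectors
   X in (Z/p + {0})^n: a monotone rank X -> [0, M), with an equivariant label
   X -> Z/p that is constant on comparable vectors of equal rank, forces n <= M.
   To prove the latter, iterated cones give chains h_i of flags of sign vectors
   with boundary alternately N h_(i-1) and T h_(i-1), where T = g - 1 and
   N = 1 + g + ... + g^(p-1); dually, there are cochains u_i on Z/p with
   coboundary alternately T u_(i+1) and N u_(i+1), vanishing on sequences with
   two equal adjacent entries.  Pairing the pullback of u_i with h_i yields 1 in
   every degree, but if n > M any flag of length n has adjacent equal labels. *)

(** * Coboundaries of cochains on finite sequences *)

Section Cochains.
Local Open Scope ring_scope.
Variables (R : comNzRingType) (V : Type).
Implicit Types (f g : seq V -> R) (s : seq V).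

(** The augmented simplicial coboundary: the alternating sum of the values of [f] on the sequences
    obtained by deleting one entry of [s]. *)
Fixpoint cobd f s : R :=
  if s is x :: s' then f s' - cobd (fun t => f (x :: t)) s' else 0.

Lemma eq_cobd f g : f =1 g -> cobd f =1 cobd g.
Proof.
move=> fg s; elim: s f g fg => //= x s IHs f g fg.
by rewrite fg (IHs _ (fun t => g (x :: t))).
Qed.

Lemma cobd0 s : cobd (fun=> 0) s = 0.
Proof. by elim: s => //= x s ->; rewrite subr0. Qed.

Lemma cobdB f g s : cobd (fun t => f t - g t) s = cobd f s - cobd g s.
Proof. by elim: s f g => [|x s IHs] f g /=; rewrite ?IHs; ring. Qed.

Lemma cobd_sum n (f : 'I_n -> seq V -> R) s :
  cobd (fun t => \sum_i f i t) s = \sum_i cobd (f i) s.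
Proof.
elim: s f => [|x s IHs] f /=; first by rewrite big1.
by rewrite IHs sumrB.
Qed.

Lemma cobd_cobd f s : cobd (cobd f) s = 0.
Proof.
elim: s f => //= x s IHs f.
by rewrite cobdB IHs subr0 subrr.
Qed.

End Cochains.

Lemma cobd_map (R : comNzRingType) (V W : Type) (h : V -> W) (f : seq W -> R) s :
  cobd (fun t => f (map h t)) s = cobd f (map h s).
Proof. by elim: s f => //= x s IHs f; rewrite (IHs (fun t => f (h x :: t))). Qed.

(** * Prisms and cones *)

Section Cone.
Local Open Scope ring_scope.
Variables (R : comNzRingType) (V : Type) (e : V) (phi : V -> V).
Implicit Types (f g : seq V -> R) (s : seq V).

Fixpoint prism f s : R :=
  if s is x :: s' then
    f [:: x, phi x & map phi s'] - prism (fun t => f (x :: t)) s'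
  else 0.

(** In the application the apex [e] need not be comparable with the entries of [s], so a prism first
    moves [s] to [map phi s], which is then coned off. By [cone_cobd], the boundary of this chain is
    [s] minus the cone over the boundary of [s]. *)
Definition cone f s : R := f (e :: map phi s) - prism f s.

Lemma eq_prism f g s :
    (forall s1 x s2, s = s1 ++ x :: s2 ->
       f (s1 ++ [:: x, phi x & map phi s2]) =
       g (s1 ++ [:: x, phi x & map phi s2])) ->
  prism f s = prism g s.
Proof.
elim: s f g => //= x s IHs f g fg.
rewrite (fg [::] x s) //; congr (_ - _); apply: IHs => s1 y s2 def_s.
by apply: (fg (x :: s1)); rewrite def_s.
Qed.

Lemma prismB f g s : prism (fun t => f t - g t) s = prism f s - prism g s.
Proof. by elim: s f g => [|x s IHs] f g /=; rewrite ?IHs; ring. Qed.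

Lemma coneB f g s : cone (fun t => f t - g t) s = cone f s - cone g s.
Proof. by rewrite /cone prismB; ring. Qed.

Lemma prism_cobd f s :
  prism (cobd f) s = f (map phi s) - f s - cobd (prism f) s.
Proof.
elim: s f => [|x s IHs] f /=; first by rewrite !subrr.
rewrite prismB IHs cobdB.
rewrite (cobd_map phi (fun t => f [:: x, phi x & t])); ring.
Qed.

Lemma cone_cobd f s : cone (cobd f) s = f s - cobd (cone f) s.
Proof.
rewrite /cone prism_cobd cobdB /= (cobd_map phi (fun t => f (e :: t))); ring.
Qed.

End Cone.

(** * Twists by a cyclic action *)

(* [twist true] is T = g - 1 and [twist false] is N = 1 + g + ... + g^(p-1). *)
Section Twist.
Local Open Scope ring_scope.
Variables (p : nat) (R : comNzRingType) (V : Type) (a : V -> V).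
Hypothesis (iter_a : forall x, iter p a x = x).
Implicit Types (f g : seq V -> R) (s : seq V) (b : bool).

Definition twist b f s : R :=
  if b then f (map a s) - f s else \sum_(j < p) f (map (iter j a) s).

Lemma eq_twist b f g s :
  (forall j, f (map (iter j a) s) = g (map (iter j a) s)) ->
  twist b f s = twist b g s.
Proof.
move=> fg; rewrite /twist; case: b; last exact: eq_bigr.
by have:= fg 1; have := fg 0; rewrite /= map_id => -> ->.
Qed.

Lemma twistB b f g s :
  twist b (fun t => f t - g t) s = twist b f s - twist b g s.
Proof. by rewrite /twist; case: b; [ring | rewrite sumrB]. Qed.

Lemma cobd_twist b f s : cobd (twist b f) s = twist b (cobd f) s.
Proof.
rewrite /twist; case: b; first by rewrite cobdB cobd_map.
by rewrite cobd_sum; apply: eq_bigr => j _; rewrite cobd_map.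
Qed.

(** In either order the composite telescopes to the p-th power of [a] minus the identity, which is 0
    by [iter_a]. *)
Lemma twist_twist b f s : twist b (twist (~~ b) f) s = 0.
Proof.
have E g : \sum_(j < p) g (map (iter j.+1 a) s) - \sum_(j < p) g (map (iter j a) s) = 0 :> R.
  rewrite -sumrB -(big_mkord xpredT (fun j => g (map (iter j.+1 a) s) - g (map (iter j a) s))).
  rewrite telescope_sumr // (eq_map iter_a) /= subrr //.
rewrite /twist; case: b => /=; last first.
  rewrite sumrB -[RHS](E f); congr (_ - _); apply: eq_bigr => j _.
  by rewrite -map_comp.
rewrite -[RHS](E f); congr (_ - _); apply: eq_bigr => j _.
by rewrite -map_comp; congr f; apply: eq_map => x; rewrite /= -iterSr.
Qed.

End Twist.

(** * The cochains u_i on sequences of labels in Z/p *)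

Section LabelCochains.
Local Open Scope ring_scope.
Variables (p : nat) (p_pr : prime p).
Local Notation F := 'F_p.
Local Notation tw := (@twist p F F (+%R 1)).
Implicit Types (f g : seq F -> F) (s : seq F).

Lemma iter_add1 j (x : F) : iter j (+%R 1) x = j%:R + x.
Proof. by rewrite iter_addr. Qed.

Lemma natrF_p : p%:R = 0 :> F.
Proof. by rewrite pchar_Fp_0. Qed.

Lemma ltn_Fp (x : F) : (x < p)%N.
Proof. by rewrite -[X in (_ < X)%N]Fp_cast. Qed.

(** A right inverse of a twist on the kernel of the opposite one. Each translation orbit of nonempty
    sequences has one member with head 0. For T, [f] is summed along the orbit from that member up
    to [s], excluded; for N, only that member keeps its value. *)
Definition untwist (b : bool) f s : F :=
  let x := head 0 s in
  if b then \sum_(j < x) f (map (+%R (j%:R - x)) s) else (x == 0)%:R * f s.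

Lemma map_add (x y : F) s : map (+%R x) (map (+%R y) s) = map (+%R (x + y)) s.
Proof. by rewrite -map_comp; apply: eq_map => z /=; rewrite addrA. Qed.

Lemma map_add0 s : map (+%R 0) s = s.
Proof. by rewrite -[RHS]map_id; apply: eq_map => x; rewrite add0r. Qed.

Lemma map_iter j s : map (iter j (+%R 1)) s = map (+%R j%:R) s.
Proof. by apply: eq_map => x; rewrite iter_add1. Qed.

Lemma head_map_add (x y : F) s : head 0 (map (+%R x) (y :: s)) = x + y.
Proof. by []. Qed.

Lemma twist_untwist b f s :
  f [::] = 0 -> (forall s, tw (~~ b) f s = 0) -> tw b (untwist b f) s = f s.
Proof.
case: s => [|x s] f0 fE.
  rewrite /twist /untwist /= f0; case: b {fE}; first by rewrite !big_ord0 subrr.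
  by rewrite big1 // => j _; rewrite mulr0.
case: b fE => fE; last first.
  have inv n : f (map (+%R n%:R) (x :: s)) = f (x :: s).
    elim: n => [|n IHn]; first by rewrite map_add0.
    rewrite -[RHS]IHn mulrS -map_add.
    by apply/eqP; rewrite -subr_eq0; apply/eqP/fE.
  rewrite /twist /untwist.
  (* Only the translation by [- x], which brings the head to 0, contributes to the sum. *)
  have [i ix] : exists i : 'I_p, i%:R = - x.
    by exists (Ordinal (ltn_Fp (- x))); apply: natr_Zp.
  rewrite (bigD1 i) // big1 => [|j /eqP ji] /=.
    by rewrite addr0 {1}iter_add1 ix addNr eqxx mul1r -[RHS](inv i) -map_iter.
  rewrite iter_add1 addr_eq0 -ix.
  case: eqP => [ji_p|]; last by rewrite mul0r.
  case: ji; apply/val_inj.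
  by rewrite /= -[val j](modn_small (ltn_ord j)) -val_Fp_nat // ji_p val_Fp_nat // modn_small.
rewrite /twist /untwist head_map_add -[head 0 (x :: s)]/x.
set y := map _ (x :: s).
have shiftE (j : nat) : map (+%R (j%:R - (1 + x))) y = map (+%R (j%:R - x)) (x :: s).
  by rewrite map_add; congr map; congr +%R; ring.
under eq_bigr do rewrite shiftE.
set G := fun j : nat => f (map (+%R (j%:R - x)) (x :: s)).
rewrite -(big_mkord xpredT G) -(big_mkord xpredT G).
have Gx : G x = f (x :: s) by rewrite /G natr_Zp subrr map_add0.
(* If [x] is p - 1, the head wraps around to 0 and the first sum is empty; the vanishing of N f then
   supplies the missing term. *)
have := ltn_Fp x; rewrite leq_eqVlt => /predU1P[xp|xp].
  have -> : 1 + x = 0 by rewrite -[x]natr_Zp -mulrS xp natrF_p.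
  rewrite big_geq // sub0r; apply/eqP; rewrite eqr_oppLR; apply/eqP.
  rewrite -Gx; apply/eqP; rewrite -addr_eq0 -big_nat_recr //= xp; apply/eqP.
  rewrite big_mkord; apply: etrans (fE (map (+%R (- x)) (x :: s))).
  by apply: eq_bigr => j _; rewrite /G map_iter map_add.
have -> : nat_of_ord (1 + x) = x.+1 :> nat.
  by rewrite -[x in LHS]natr_Zp -mulrS val_Fp_nat // modn_small.
by rewrite big_nat_recr //= Gx [_ + f _]addrC addrK.
Qed.

Fixpoint bar i : seq F -> F :=
  if i is i'.+1 then untwist (odd i') (cobd (bar i')) else fun s => (nilp s)%:R.

(** [twist_untwist] applies since the opposite twist kills [cobd (bar i)]: [bar 0] is invariant, and
    later, as twists commute with [cobd], induction leads to a double coboundary. *)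
Lemma cobd_bar i s : cobd (bar i) s = tw (odd i) (bar i.+1) s.
Proof.
elim: i s => [|i IHi] s; rewrite [bar _.+1]/= twist_untwist // => {}s.
  rewrite -cobd_twist (@eq_cobd _ _ _ (fun=> 0)) ?cobd0 // => t.
  by rewrite /twist /= /nilp size_map subrr.
rewrite -cobd_twist -[RHS](cobd_cobd (bar i) s); apply: eq_cobd => t.
by rewrite [~~ _]/= negbK -IHi.
Qed.

Definition normalized f := forall s, ~~ sorted (fun x y => x != y) s -> f s = 0.

(** Deleting either of two equal adjacent entries gives the same sequence with opposite signs; every
    other deletion keeps the pair. *)
Lemma cobd_normalized f : normalized f -> normalized (cobd f).
Proof.
move=> nf s; elim: s f nf => // x [|y s] IHs f nf //= ns.
have [xy|xy] := eqVneq x y; last first.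
  have ns' : ~~ sorted (fun x y => x != y) (y :: s) by rewrite xy in ns.
  rewrite (nf _ ns') add0r; apply/eqP; rewrite oppr_eq0; apply/eqP.
  apply: (IHs (fun t => f (x :: t))) => // t nt; apply: nf.
  by case: t nt => //= z t; rewrite negb_and => ->; rewrite orbT.
rewrite xy opprB addrC subrK; apply: etrans (cobd0 _ s); apply: eq_cobd => t.
by apply: nf; rewrite /= eqxx.
Qed.

Lemma sorted_map_add (x : F) s :
  sorted (fun y z => y != z) (map (+%R x) s) = sorted (fun y z => y != z) s.
Proof.
rewrite sorted_map; apply: eq_sorted => y z /=.
by rewrite (inj_eq (addrI x)).
Qed.

Lemma bar_normalized i : normalized (bar i).
Proof.
elim: i => [|i IHi] s ns; first by case: s ns.
have nf := cobd_normalized IHi; rewrite [bar _]/= /untwist.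
case: odd; last by rewrite nf ?mulr0.
by rewrite big1 // => j _; rewrite nf // sorted_map_add.
Qed.

End LabelCochains.

(** * Chains of flags of sign vectors and the Z/p-Tucker lemma *)

Section Tucker.
Local Open Scope ring_scope.
Variables (p : nat) (p_pr : prime p) (C : finType).
Local Notation F := 'F_p.
Local Notation vec := {ffun C -> option F}.
Implicit Types (X Y : vec) (s : seq vec) (f g : seq vec -> F) (es : seq C).

Definition turn X : vec := [ffun i => omap (+%R 1) (X i)].
Definition le_vec X Y := [forall i, (X i == None) || (X i == Y i)].
Definition put e X : vec := [ffun i => if i == e then Some 0 else X i].
Definition unit_vec e := put e [ffun => None].
Definition supported es X :=
  [exists i, X i != None] && [forall i, (X i != None) ==> (i \in es)].

Definition flag es s :=
  [&& size s == size es, sorted le_vec s & all (supported es) s].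

Local Notation tw := (@twist p F vec turn).

Lemma iter_turnE j X i : iter j turn X i = omap (+%R j%:R) (X i).
Proof.
elim: j => [|j IHj] /=; first by case: (X i) => //= x; rewrite add0r.
by rewrite ffunE IHj; case: (X i) => //= x; rewrite addrA -mulrS.
Qed.

Lemma iter_turn_p X : iter p turn X = X.
Proof.
apply/ffunP => i; rewrite iter_turnE; case: (X i) => //= x.
by rewrite natrF_p // add0r.
Qed.

Lemma le_vecP X Y : reflect (forall i, X i <> None -> X i = Y i) (le_vec X Y).
Proof.
apply: (iffP forallP) => XY i; first by have /orP[/eqP|/eqP] := XY i.
by case: eqP => //= Xi; rewrite XY.
Qed.

Lemma supportedP es X :
  reflect ((exists i, X i != None) /\ (forall i, X i != None -> i \in es))
          (supported es X).
Proof.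
apply: (iffP andP) => -[].
  by move=> /existsP X0 /forallP supX; split=> // i; apply/implyP.
by move=> X0 supX; split; [apply/existsP | apply/forallP => i; apply/implyP/supX].
Qed.

Lemma le_turn j X Y : le_vec X Y -> le_vec (iter j turn X) (iter j turn Y).
Proof.
move=> /le_vecP XY; apply/le_vecP => i; rewrite !iter_turnE => Xi.
by rewrite -XY //; case: (X i) Xi.
Qed.

Lemma supported_turn es j X : supported es (iter j turn X) = supported es X.
Proof.
have E i : (iter j turn X i != None) = (X i != None).
  by rewrite iter_turnE; case: (X i).
by congr (_ && _); [apply: eq_existsb | apply: eq_forallb => i; congr (_ ==> _)].
Qed.

Lemma flag_turn es j s : flag es s -> flag es (map (iter j turn) s).
Proof.
case/and3P=> sz srt sup; rewrite /flag size_map sz all_map.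
rewrite (homo_sorted (@le_turn j)) //=.
by apply: sub_all sup => X; rewrite /= supported_turn.
Qed.

Lemma le_put e X Y : le_vec X Y -> le_vec (put e X) (put e Y).
Proof.
move=> /le_vecP XY; apply/le_vecP => i; rewrite !ffunE.
by case: ifP => // _; apply: XY.
Qed.

Lemma le_put_id e es X : e \notin es -> supported es X -> le_vec X (put e X).
Proof.
move=> e_es /supportedP[_ supX]; apply/le_vecP => i; rewrite !ffunE.
by case: eqP => // -> /eqP/supX; rewrite (negPf e_es).
Qed.

Lemma le_unit_put e X : le_vec (unit_vec e) (put e X).
Proof. by apply/le_vecP => i; rewrite !ffunE; case: ifP. Qed.

Lemma supported_unit e es : supported (e :: es) (unit_vec e).
Proof.
apply/supportedP; split; first by exists e; rewrite ffunE eqxx.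
by move=> i; rewrite !ffunE inE; case: (i == e).
Qed.

Lemma supported_cons e es X : supported es X -> supported (e :: es) X.
Proof.
by case/supportedP=> X0 supX; apply/supportedP; split=> // i /supX; rewrite inE => ->; rewrite orbT.
Qed.

Lemma supported_put e es X : supported es X -> supported (e :: es) (put e X).
Proof.
case/supportedP=> X0 supX; apply/supportedP; split.
  by exists e; rewrite ffunE eqxx.
by move=> i; rewrite ffunE inE; case: (i == e) => //=; apply: supX.
Qed.

Lemma flag_unit_put e es s :
  flag es s -> flag (e :: es) (unit_vec e :: map (put e) s).
Proof.
case/and3P=> sz srt sup; rewrite /flag /= size_map eqSS sz supported_unit all_map /=.
apply/andP; split; last by apply: sub_all sup => X; apply: supported_put.
have := homo_sorted (@le_put e) _ srt.
by case: s {sz srt sup} => //= X s ->; rewrite le_unit_put.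
Qed.

(** [X] vanishes at [e], so [put e X] extends it. With [flag_unit_put], this keeps cones inside the
    flags. *)
Lemma flag_prism e es s1 X s2 :
    e \notin es -> flag es (s1 ++ X :: s2) ->
  flag (e :: es) (s1 ++ [:: X, put e X & map (put e) s2]).
Proof.
move=> e_es /and3P[sz srt sup]; apply/and3P; split.
- by move: sz; rewrite !size_cat /= size_map => /eqP <-; rewrite !addnS.
- have srtX : path le_vec X s2 -> path le_vec X (put e X :: map (put e) s2).
    move=> /(homo_path (@le_put e)) /= ->; rewrite andbT (le_put_id e_es) //.
    by move: sup; rewrite all_cat /= => /and3P[].
  case: s1 srt {sz sup} => [|Y s1]; first exact: srtX.
  by rewrite /= !cat_path => /andP[->] /andP[/= -> /srtX].
- move: sup; rewrite !all_cat /= all_map => /and3P[sup1 supX sup2].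
  rewrite supported_cons // supported_put //= (sub_all _ sup1) /=.
    by apply: sub_all sup2 => Y; apply: supported_put.
  exact: supported_cons.
Qed.

(** The parity matches [cobd_bar]: on a list of size [i.+1] this is [twist (odd i)]. The empty list
    carries no twist, so the boundary of h_1 is the empty sequence itself. *)
Definition otwist es f : seq vec -> F :=
  if es is [::] then f else tw (~~ odd (size es)) f.

(* Evaluation on the iterated cone h_i = cone (T h_(i-1)) or cone (N h_(i-1)),
   a chain of flags whose boundary is T h_(i-1) or N h_(i-1). *)
Fixpoint iter_cone es f : F :=
  if es is e :: es' then iter_cone es' (otwist es' (cone (unit_vec e) (put e) f))
  else f [::].

Lemma eq_otwist es f g s :
  (forall j, f (map (iter j turn) s) = g (map (iter j turn) s)) ->
  otwist es f s = otwist es g s.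
Proof.
case: es => [|e es] fg; last exact: eq_twist.
by have := fg 0%N; rewrite map_id.
Qed.

Lemma eq_iter_cone es f g :
  uniq es -> (forall s, flag es s -> f s = g s) -> iter_cone es f = iter_cone es g.
Proof.
elim: es f g => [|e es IHes] f g /=; first by move=> _ -> //.
case/andP=> e_es es_uniq fg; apply: IHes => // s s_es; apply: eq_otwist => j.
move: (flag_turn j s_es); move: (map _ s) => {s s_es}s s_es.
rewrite /cone fg ?flag_unit_put //; congr (_ - _).
by apply: eq_prism => s1 X s2 def_s; apply/fg/flag_prism; rewrite -?def_s.
Qed.

Lemma iter_coneB es f g :
  uniq es -> iter_cone es (fun s => f s - g s) = iter_cone es f - iter_cone es g.
Proof.
elim: es f g => //= e es IHes f g /andP[_ es_uniq].
rewrite -IHes //; apply: eq_iter_cone => // s _.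
case: es {IHes es_uniq} => [|e' es] /=; first exact: coneB.
by rewrite -twistB; apply: eq_twist => j; rewrite coneB.
Qed.

Lemma iter_cone0 es : uniq es -> iter_cone es (fun=> 0) = 0.
Proof.
move=> es_uniq; rewrite -[RHS](subrr (iter_cone es (fun=> 0))) -iter_coneB //.
by apply: eq_iter_cone => // s _; rewrite subrr.
Qed.

(** By [cone_cobd] the left side is the right side minus a coboundary term, and by induction that
    term meets two consecutive opposite twists, hence vanishes. *)
Lemma iter_cone_cobd e es f :
  uniq (e :: es) -> iter_cone (e :: es) (cobd f) = iter_cone es (otwist es f).
Proof.
elim: es e f => [|e' es IHes] e f es_uniq; first by rewrite /= /cone /= !subr0.
have es'_uniq : uniq (e' :: es) by case/andP: es_uniq.
set G := cone (unit_vec e) (put e) f.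
transitivity (iter_cone (e' :: es) (otwist (e' :: es) f) -
              iter_cone (e' :: es) (cobd (otwist (e' :: es) G))).
  rewrite -iter_coneB //.
  apply: (@eq_iter_cone (e' :: es)
            (otwist (e' :: es) (cone (unit_vec e) (put e) (cobd f)))) => // s _.
  rewrite cobd_twist /otwist -twistB; apply: eq_twist => j.
  exact: cone_cobd.
rewrite IHes // [X in _ - X](_ : _ = 0) ?subr0 //.
have es_u : uniq es by case/andP: es'_uniq.
case: es es_u {IHes es_uniq es'_uniq} => [|e'' es] es_u.
  (* On the empty sequence N is multiplication by p, which is 0 with coefficients in ['F_p]. *)
  by rewrite /= /twist /= sumr_const card_ord -mulr_natl natrF_p // mul0r.
rewrite -[RHS](iter_cone0 es_u); apply: eq_iter_cone => // s _.
have := twist_twist iter_turn_p (odd (size es)) G s.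
by rewrite /otwist /= !negbK.
Qed.

Variables (S : {set C}) (M : nat) (rk : vec -> nat) (lab : vec -> F).
Hypothesis rk_bound : forall X, supported (enum S) X -> (rk X < M)%N.
Hypothesis rk_mono : forall X Y,
  supported (enum S) X -> supported (enum S) Y -> le_vec X Y -> (rk X <= rk Y)%N.
Hypothesis lab_const : forall X Y,
  supported (enum S) X -> supported (enum S) Y -> le_vec X Y -> rk X = rk Y ->
  lab X = lab Y.
Hypothesis lab_turn : forall X, supported (enum S) X -> lab (turn X) = 1 + lab X.

Lemma supported_subset es X :
  {subset es <= S} -> supported es X -> supported (enum S) X.
Proof.
move=> sub /supportedP[X0 supX]; apply/supportedP; split=> // i /supX/sub.
by rewrite mem_enum.
Qed.

Lemma lab_iter_turn j X :
  supported (enum S) X -> lab (iter j turn X) = iter j (+%R 1) (lab X).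
Proof.
by move=> supX; elim: j => //= j IHj; rewrite lab_turn ?supported_turn // IHj.
Qed.

(** [cobd_bar] turns the twisted cochain into a coboundary and [iter_cone_cobd] moves it to the
    shorter list; on the empty list the value is 1. *)
Lemma iter_cone_bar es : uniq es -> {subset es <= S} ->
  iter_cone es (otwist es (fun s => @bar p (size es) (map lab s))) = 1.
Proof.
elim: es => [|e es IHes] // es_uniq sub_es.
have [es_uniq' sub_es'] : uniq es /\ {subset es <= S}.
  by split=> [|i i_es]; [case/andP: es_uniq | apply: sub_es; rewrite inE i_es orbT].
apply: etrans (IHes es_uniq' sub_es'); rewrite -(iter_cone_cobd _ es_uniq).
apply: eq_iter_cone => // s /and3P[_ _ /allP sup].
rewrite cobd_map (cobd_bar p_pr) /otwist /= negbK /twist.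
have E j : map lab (map (iter j turn) s) = map (iter j (+%R 1)) (map lab s).
  rewrite -!map_comp; apply/eq_in_map => X /sup supX /=.
  by rewrite lab_iter_turn // (supported_subset sub_es).
case: odd; first by have := E 1%N => /= ->.
by apply: eq_bigr => j _; rewrite E.
Qed.

Lemma flag_rk_sorted s :
    all (supported (enum S)) s -> sorted le_vec s ->
  sorted (fun x y => x != y) (map lab s) -> sorted ltn (map rk s).
Proof.
elim: s => // X [|Y s] IHs //= /and3P[supX supY sups] /andP[XY srt] /andP[labXY labs].
rewrite [path _ _ _]IHs //= ?supY // andbT ltn_neqAle rk_mono // andbT.
by apply: contra labXY => /eqP rkXY; rewrite (lab_const supX supY).
Qed.

Theorem monotone_tucker : (#|S| <= M)%N.
Proof.
rewrite leqNgt; apply/negP => ltMS.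
have sub_S : {subset enum S <= S} by move=> i; rewrite mem_enum.
have /eqP := iter_cone_bar (enum_uniq S) sub_S.
rewrite (@eq_iter_cone _ _ (fun=> 0)) ?enum_uniq // => [|s flag_s].
  by rewrite iter_cone0 ?enum_uniq // eq_sym oner_eq0.
rewrite (@eq_otwist _ _ (fun=> 0)) => [|j].
  rewrite /otwist; case: (enum S) => // a l.
  by rewrite /twist; case: (~~ _); rewrite ?subrr ?big1.
have /and3P[/eqP sz srt sup] := flag_turn j flag_s.
(* If all adjacent labels differed, the [#|S|] vectors of the flag would have distinct ranks below
   [M]. *)
apply: bar_normalized; apply: contraL ltMS => labs; rewrite -leqNgt cardE -sz.
rewrite -(size_map rk) -[leqRHS](size_iota 0); apply: uniq_leq_size.
  exact: sorted_uniq ltn_trans ltnn _ (flag_rk_sorted sup srt labs).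
by move=> _ /mapP[X /(allP sup) supX ->]; rewrite mem_iota add0n rk_bound.
Qed.

End Tucker.

(** * Transversal sets and monochromatic families *)

Section Transversals.
Variables (T W : finType) (pi : T -> W).
Implicit Types (A S : {set T}) (c : {set T} -> nat).

Definition transversal k A := (#|A| == k) && (#|pi @: A| == k).

Lemma transversalP k A :
  reflect (#|A| = k /\ {in A &, injective pi}) (transversal k A).
Proof.
apply: (iffP andP) => -[/eqP Ak]; first by move=> /eqP piA; split=> //; apply/imset_injP; rewrite piA Ak.
by move=> /card_in_imset ->; rewrite Ak.
Qed.

Lemma transversal_exists k S :
  k <= #|pi @: S| -> exists2 A : {set T}, A \subset S & transversal k A.
Proof.
elim: k => [|k IHk] kS.
  by exists set0; rewrite ?sub0set // /transversal imset0 !cards0.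
have [A AS /andP[/eqP Ak /eqP piA]] := IHk (ltnW kS).
have : ~~ (pi @: S \subset pi @: A).
  by apply/negP => /subset_leq_card; rewrite piA leqNgt kS.
case/subsetPn => _ /imsetP[z zS ->] zA.
exists (z |: A); first by rewrite subUset sub1set zS.
have zA' : z \notin A by apply: contra zA; apply: imset_f.
by rewrite /transversal imsetU1 !cardsU1 zA zA' piA Ak eqxx.
Qed.

(** Being boolean, it can be searched by [pick]; the index type is free so that families can be
    indexed by ['F_p], by ordinals or by pairs. *)
Definition mono_family (I : finType) k c S i :=
  [exists A : {ffun I -> {set T}},
     [forall j, [&& transversal k (A j), A j \subset S & c (A j) == i]] &&
     [forall j, forall j', (j != j') ==> [disjoint A j & A j']]].

Lemma mono_familyP (I : finType) k c S i :
  reflect (exists2 A : I -> {set T},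
            forall j, [/\ transversal k (A j), A j \subset S & c (A j) = i]
            & forall j j', j != j' -> [disjoint A j & A j'])
          (mono_family I k c S i).
Proof.
apply: (iffP existsP) => [[A /andP[/forallP colA /forallP disA]]|[A colA disA]].
  exists A => [j|j j']; first by case/and3P: (colA j) => ? ? /eqP.
  by move: (disA j) => /forallP/(_ j')/implyP; apply.
exists [ffun j => A j]; apply/andP; split; apply/forallP => j.
  by rewrite ffunE; case: (colA j) => -> -> ->; rewrite eqxx.
by apply/forallP => j'; rewrite !ffunE; apply/implyP/disA.
Qed.

Lemma mono_family_inj (I J : finType) (f : J -> I) k c S i :
  injective f -> mono_family I k c S i -> mono_family J k c S i.
Proof.
move=> f_inj /mono_familyP[A colA disA]; apply/mono_familyP.
by exists (A \o f) => [j|j j' jj']; [apply: colA | apply: disA; rewrite (inj_eq f_inj)].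
Qed.

Lemma mono_family_card (I J : finType) k c S i :
  #|J| <= #|I| -> mono_family I k c S i -> mono_family J k c S i.
Proof.
move=> leJI; apply: (@mono_family_inj _ _ (fun j => enum_val (widen_ord leJI (enum_rank j)))).
by move=> j j' /enum_val_inj/(congr1 val)/= /val_inj/enum_rank_inj.
Qed.

End Transversals.

(** The lower bound in contrapositive form. Parts are fibers of an arbitrary map and the ground set
    is an arbitrary subset, so that it applies to refined partitions and inside smaller sets. *)
Definition kneser_bound r := forall (T W : finType) (pi : T -> W) k m c (S : {set T}),
  0 < k ->
  (forall w, #|[set x in S | pi x == w]| <= r) ->
  (forall A : {set T}, A \subset S -> transversal pi k A -> c A < m) ->
  r * k.-1 + r.-1 * m < #|S| ->
  exists i : 'I_m, mono_family pi 'I_r k c S i.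

(** * Equivariant choice of a point from a subset of Z/p *)

Section Mean.
Local Open Scope ring_scope.
Variables (p : nat) (p_pr : prime p).
Local Notation F := 'F_p.
Implicit Type B : {set F}.

Definition mean B : F := (\sum_(x in B) x) / #|B|%:R.
Definition shift B : {set F} := [set x | x - 1 \in B].

Lemma shift_imset B : shift B = +%R 1 @: B.
Proof.
apply/setP => x; rewrite inE; apply/idP/imsetP => [xB|[y yB ->]].
  by exists (x - 1); rewrite // addrC subrK.
by rewrite addrC addKr.
Qed.

Lemma card_shift B : #|shift B| = #|B|.
Proof. by rewrite shift_imset card_imset //; apply: addrI. Qed.

Lemma shift_eq0 B : (shift B == set0) = (B == set0).
Proof. by rewrite -!cards_eq0 card_shift. Qed.

Lemma shift_eqT B : (shift B == setT) = (B == setT).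
Proof. by rewrite !eqEcard !subsetT /= card_shift. Qed.

(** The sum grows by [#|B|], which is invertible modulo p because it lies strictly between 0 and
    p. *)
Lemma mean_shift B : B != set0 -> B != setT -> mean (shift B) = 1 + mean B.
Proof.
move=> B0 BT; rewrite /mean card_shift shift_imset big_imset /=; last by move=> x y _ _ /addrI.
rewrite big_split /= sumr_const mulrDl divff // -(dvdn_pcharf (pchar_Fp p_pr)).
apply/negP => /dvdn_leq; rewrite card_gt0 B0 => /(_ isT).
rewrite leqNgt => /negP; apply.
by rewrite -[ltnRHS](card_Fp p_pr) -cardsT proper_card // properT.
Qed.

Lemma eq_of_sum_card (I : finType) (A B : I -> {set F}) :
    (forall i, A i \subset B i) -> (\sum_i #|A i| = \sum_i #|B i|)%N ->
  forall i, A i = B i.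
Proof.
move=> AB sumAB i.
have := leqif_sum (fun i (_ : true) => subset_leqif_cards (AB i)).
by case=> _ ; rewrite sumAB eqxx => /esym/forallP/(_ i)/eqP.
Qed.

End Mean.

(** * The lower bound for prime r *)

Section PrimeKneser.
Local Open Scope ring_scope.
Variables (p : nat) (p_pr : prime p) (T W : finType) (pi : T -> W) (k m : nat).
Variables (c : {set T} -> nat) (S : {set T}).
Hypothesis k_gt0 : (0 < k)%N.
Hypothesis fiber_le : forall w, (#|[set x in S | pi x == w]| <= p)%N.
Hypothesis color_lt :
  forall A : {set T}, A \subset S -> transversal pi k A -> (c A < m)%N.
Hypothesis no_mono : forall i : 'I_m, ~~ mono_family pi 'F_p k c S i.
Local Notation F := 'F_p.
Local Notation vec := {ffun T -> option F}.
Local Notation supp := (supported (enum S)).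
Implicit Types (X Y : vec) (x : F) (w : W) (i : 'I_m).

Definition cls X x : {set T} := [set t | X t == Some x].
Definition signs X w : {set F} := [set x | w \in pi @: cls X x].
Definition hues X i : {set F} :=
  [set x | [exists A : {set T}, [&& transversal pi k A, A \subset cls X x & c A == i]]].
Definition nsigns X := (\sum_w #|signs X w|)%N.
Definition nhues X := (\sum_i #|hues X i|)%N.

(* If few pairs (part, sign) occur in X, count them; otherwise some sign class
   of X contains a vertex, and count the pairs (color, sign) instead. *)
Definition kneser_rk X :=
  if nhues X == 0%N then (nsigns X).-1 else (p * k.-1 + (nhues X).-1)%N.

(* A proper nonempty subset of Z/p has a mean, which is equivariant under
   translation.  If all p signs occur in a part, X is a bijection from that part
   to the signs, and the sign of a fixed element is used instead. *)
Definition kneser_lab X : F :=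
  if [pick i | hues X i != set0] is Some i then mean (hues X i) else
  if [pick w | signs X w != set0] is Some w then
    if signs X w == setT then
      odflt 0 (obind (fun t => X t) [pick t in S | pi t == w])
    else mean (signs X w)
  else 0.

Lemma cls_turn X x : cls (turn X) x = cls X (x - 1).
Proof.
apply/setP => t; rewrite !inE ffunE; case: (X t) => //= y.
by rewrite !(inj_eq Some_inj) [RHS]eq_sym subr_eq [RHS]eq_sym (addrC y).
Qed.

Lemma signs_turn X w : signs (turn X) w = shift (signs X w).
Proof. by apply/setP => x; rewrite !inE cls_turn. Qed.

Lemma hues_turn X i : hues (turn X) i = shift (hues X i).
Proof. by apply/setP => x; rewrite !inE cls_turn. Qed.

Lemma cls_le X Y x : le_vec X Y -> cls X x \subset cls Y x.
Proof.
move=> /le_vecP XY; apply/subsetP => t; rewrite !inE => /eqP Xt.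
by rewrite -XY Xt.
Qed.

Lemma signs_le X Y w : le_vec X Y -> signs X w \subset signs Y w.
Proof.
move=> XY; apply/subsetP => x; rewrite !inE.
exact/subsetP/imsetS/cls_le.
Qed.

Lemma hues_le X Y i : le_vec X Y -> hues X i \subset hues Y i.
Proof.
move=> XY; apply/subsetP => x; rewrite !inE => /existsP[A /and3P[kA AX cA]].
by apply/existsP; exists A; rewrite kA cA (subset_trans AX) // cls_le.
Qed.

Lemma nhues_le X Y : le_vec X Y -> (nhues X <= nhues Y)%N.
Proof. by move=> XY; apply: leq_sum => i _; rewrite subset_leq_card ?hues_le. Qed.

Lemma nsigns_le X Y : le_vec X Y -> (nsigns X <= nsigns Y)%N.
Proof. by move=> XY; apply: leq_sum => i _; rewrite subset_leq_card ?signs_le. Qed.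

Lemma cls_sub X x : supp X -> cls X x \subset S.
Proof.
move=> /supportedP[_ supX]; apply/subsetP => t; rewrite inE => /eqP Xt.
by rewrite -mem_enum supX // Xt.
Qed.

(** Distinct sign classes are disjoint, so one vertex of color [i] in each of the p classes would
    contradict [no_mono]. *)
Lemma hues_neqT X i : supp X -> hues X i != setT.
Proof.
move=> supX; apply: contra (no_mono i) => /eqP huesT; apply/mono_familyP.
have hue x : {A : {set T} | [&& transversal pi k A, A \subset cls X x & c A == i]}.
  by apply/sigW/existsP; have := in_setT x; rewrite -huesT inE.
exists (fun x => sval (hue x)) => [x|x y xy].
  case: (hue x) => A /= /and3P[kA AX /eqP cA]; split=> //.
  exact: subset_trans AX (cls_sub _ supX).
case: (hue x) (hue y) => A /= /and3P[_ AX _] [B /= /and3P[_ BX _]].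
rewrite -setI_eq0; apply: contraR xy => /set0Pn[t /setIP[tA tB]].
have := subsetP AX t tA; have := subsetP BX t tB; rewrite !inE => /eqP -> /eqP[->].
by [].
Qed.

Lemma nhues_bound X : supp X -> (nhues X <= p.-1 * m)%N.
Proof.
move=> supX; rewrite mulnC -[X in (_ <= X * _)%N]card_ord -sum_nat_const; apply: leq_sum => i _.
rewrite -ltnS prednK ?prime_gt0 // -[ltnRHS](card_Fp p_pr) -cardsT.
by rewrite proper_card // properT hues_neqT.
Qed.

Lemma nsignsE X : nsigns X = (\sum_x #|pi @: cls X x|)%N.
Proof.
rewrite /nsigns; under eq_bigr do rewrite -sum1_card big_mkcond /=.
rewrite exchange_big /=; apply: eq_bigr => x _.
by rewrite -sum1_card [RHS]big_mkcond /=; apply: eq_bigr => w _; rewrite inE.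
Qed.

(** Counted by sign: a sign class meeting [k] parts would contain a vertex, whose color would make
    [nhues X] positive. *)
Lemma nsigns_bound X : supp X -> nhues X = 0%N -> (nsigns X <= p * k.-1)%N.
Proof.
move=> supX /eqP; rewrite /nhues sum_nat_eq0 => /forallP hues0.
rewrite nsignsE -[X in (_ <= X * _)%N](card_Fp p_pr) -sum_nat_const; apply: leq_sum => x _.
rewrite leqNgt prednK //; apply/negP => /transversal_exists[A AX kA].
have AS := subset_trans AX (cls_sub _ supX).
have := hues0 (Ordinal (color_lt AS kA)); rewrite /= cards_eq0 => /eqP/setP/(_ x).
by rewrite !inE => /negbT/existsPn/(_ A); rewrite kA AX /= eqxx.
Qed.

Lemma nsigns_gt0 X : supp X -> (0 < nsigns X)%N.
Proof.
move=> /supportedP[[t]]; case Xt: (X t) => [x|] // _ _.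
rewrite /nsigns (bigD1 (pi t)) //= addn_gt0 card_gt0; apply/orP; left.
by apply/set0Pn; exists x; rewrite inE; apply: imset_f; rewrite inE Xt.
Qed.

Lemma nhues_eq0 X : nhues X = 0%N -> forall i, hues X i = set0.
Proof.
move=> /eqP; rewrite /nhues sum_nat_eq0 => /forallP h0 i.
by apply/eqP; rewrite -cards_eq0; apply: h0.
Qed.

(** The part has at most p elements in [S] and all p signs occur on it, so none of these elements is
    left without a sign. *)
Lemma signs_setT X w t :
  supp X -> signs X w = setT -> t \in S -> pi t = w -> X t != None.
Proof.
move=> supX sT tS pit.
pose Z := [set u in S | pi u == w]; pose Z' := [set u in Z | X u != None].
have ZZ' : Z' = Z.
  apply/eqP; rewrite eqEcard; apply/andP; split.
    by apply/subsetP => u; rewrite !inE => /andP[].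
  apply: leq_trans (fiber_le w) _; rewrite -[leqLHS](card_Fp p_pr) -cardsT.
  apply: leq_trans (leq_imset_card (fun u => odflt 0 (X u)) _).
  apply/subset_leq_card/subsetP => x _.
  have := in_setT x; rewrite -sT inE => /imsetP[u Xu piu]; apply/imsetP.
  have uS := subsetP (cls_sub x supX) _ Xu.
  move: Xu; rewrite inE => /eqP Xu.
  by exists u; rewrite ?inE ?uS ?piu ?eqxx Xu.
have : t \in Z by rewrite inE tS pit eqxx.
by rewrite -ZZ' inE => /andP[].
Qed.

Lemma kneser_rk_bound X :
  supp X -> (kneser_rk X < p * k.-1 + p.-1 * m)%N.
Proof.
move=> supX; rewrite /kneser_rk; case: eqP => [h0|/eqP h0].
  by rewrite prednK ?nsigns_gt0 // (leq_trans (nsigns_bound supX h0)) ?leq_addr.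
by rewrite ltn_add2l prednK ?lt0n // nhues_bound.
Qed.

(** Both counts are monotone, and passing from signs to hues jumps from below [p * k.-1] to at least
    that value. *)
Lemma kneser_rk_le X Y :
  supp X -> supp Y -> le_vec X Y -> (kneser_rk X <= kneser_rk Y)%N.
Proof.
move=> supX supY XY; have := nhues_le XY; have := nsigns_le XY.
have := nsigns_bound supX; rewrite /kneser_rk.
by case: eqP => [hX|hX]; case: eqP => hY; lia.
Qed.

(** Equal ranks put [X] and [Y] in the same regime with equal counts; as the sets counted are
    nested, they coincide. *)
Lemma kneser_lab_const X Y :
  supp X -> supp Y -> le_vec X Y -> kneser_rk X = kneser_rk Y ->
  kneser_lab X = kneser_lab Y.
Proof.
move=> supX supY XY; have leXY := nhues_le XY.
rewrite /kneser_rk /kneser_lab; case: eqP => [hX|hX]; case: eqP => hY; try lia; last first.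
- move=> eq_h; have {}eq_h : nhues X = nhues Y by lia.
  have hE := eq_of_sum_card (fun i => hues_le i XY) eq_h.
  have -> : [pick i | hues X i != set0] = [pick i | hues Y i != set0].
    by apply: eq_pick => i; rewrite /= hE.
  case: pickP => [i _|h0]; first by rewrite hE.
  by case: hY; rewrite /nhues big1 // => i _; have /negbFE/eqP -> := h0 i; rewrite cards0.
- move=> eq_s; have := nsigns_bound supX hX; have := nsigns_gt0 supX.
  by lia.
move=> eq_s; have {}eq_s : nsigns X = nsigns Y.
  have := nsigns_gt0 supX; have := nsigns_gt0 supY; lia.
have sE := eq_of_sum_card (fun w => signs_le w XY) eq_s.
have -> : [pick i | hues X i != set0] = None.
  by case: pickP => // i; rewrite /= nhues_eq0 ?eqxx.
have -> : [pick i | hues Y i != set0] = None.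
  by case: pickP => // i; rewrite /= nhues_eq0 ?eqxx.
have -> : [pick w | signs X w != set0] = [pick w | signs Y w != set0].
  by apply: eq_pick => w; rewrite /= sE.
case: pickP => // w _; rewrite -sE; case: eqP => // sT.
case: pickP => //= t /andP[tS /eqP piw].
by have /eqP := signs_setT supX sT tS piw; move/le_vecP: XY => XY /XY ->.
Qed.

Lemma kneser_lab_turn X : supp X -> kneser_lab (turn X) = 1 + kneser_lab X.
Proof.
move=> supX; rewrite /kneser_lab.
have -> : [pick i | hues (turn X) i != set0] = [pick i | hues X i != set0].
  by apply: eq_pick => i; rewrite /= hues_turn shift_eq0.
case: pickP => [i hi|_]; first by rewrite hues_turn mean_shift ?hues_neqT.
have -> : [pick w | signs (turn X) w != set0] = [pick w | signs X w != set0].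
  by apply: eq_pick => w; rewrite /= signs_turn shift_eq0.
(* A supported vector is nonzero, so some part carries a sign and the default label 0 is not
   reached. *)
case: pickP => [w sw|s0]; last first.
  have := nsigns_gt0 supX; rewrite /nsigns big1 // => w _.
  by have /negbFE/eqP -> := s0 w; rewrite cards0.
rewrite signs_turn shift_eqT; case: eqP => [sT|/eqP sT]; last by rewrite mean_shift.
case: pickP => [t /andP[tS /eqP pit]|S0] /=.
  by rewrite ffunE; have := signs_setT supX sT tS pit; case: (X t).
case/set0Pn: sw => x; rewrite inE => /imsetP[t Xt piw].
by have := S0 t; rewrite (subsetP (cls_sub x supX) _ Xt) piw eqxx.
Qed.

Lemma kneser_prime_bound : (#|S| <= p * k.-1 + p.-1 * m)%N.
Proof.
apply: (monotone_tucker p_pr (rk := kneser_rk) (lab := kneser_lab)).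
- exact: kneser_rk_bound.
- exact: kneser_rk_le.
- exact: kneser_lab_const.
- exact: kneser_lab_turn.
Qed.

End PrimeKneser.

(** * From prime r to all positive r *)

Lemma kneser_bound_prime p : prime p -> kneser_bound p.
Proof.
move=> p_pr T W pi k m c S k_gt0 fiber_le color_lt; rewrite ltnNge => /negP ltS.
case: (pickP (fun i : 'I_m => mono_family pi 'F_p k c S i)) => [i mono_i|no_mono].
  by exists i; move: mono_i; apply: mono_family_card; rewrite card_Fp ?card_ord.
case: ltS; apply: (kneser_prime_bound p_pr k_gt0 fiber_le color_lt) => i.
exact/negbT/no_mono.
Qed.

Lemma kneser_bound1 : kneser_bound 1.
Proof.
move=> T W pi k m c S k_gt0 fiber_le color_lt.
rewrite mul1n mul0n addn0 prednK // => kS.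
have pi_inj : {in S &, injective pi}.
  move=> x y xS yS pixy; have /card_le1_eqP := fiber_le (pi x).
  by apply; rewrite inE ?xS ?yS ?pixy /=.
have [|A AS kA] := @transversal_exists _ _ pi k S; first by rewrite card_in_imset.
exists (Ordinal (color_lt A AS kA)); apply/mono_familyP.
by exists (fun=> A) => [//|j j']; rewrite !ord1 eqxx.
Qed.

(* Refine each fiber of pi into q fibers of size at most p, and color a
   sufficiently large set by the color of a monochromatic q-family inside. *)
Lemma kneser_bound_mul q p :
  0 < q -> 0 < p -> kneser_bound q -> kneser_bound p -> kneser_bound (q * p).
Proof.
move=> q_gt0 p_gt0 bound_q bound_p T W pi k m c S k_gt0 fiber_le color_lt ltS.
pose fiber w := [set x in S | pi x == w].
pose idx x := index x (enum (fiber (pi x))).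
(* Positions within a part are split by residue modulo [q]; at most [q * p] positions leave at most
   [p] in each class. *)
pose pi' x := (pi x, Ordinal (ltn_pmod (idx x) q_gt0)).
pose k' := (q * k.-1 + q.-1 * m).+1.
pose c' N := if [pick i : 'I_m | mono_family pi 'I_q k c N i] is Some i
             then val i else 0.
have mono_q (N : {set T}) : N \subset S -> transversal pi' k' N ->
    exists2 i : 'I_m, c' N = i & mono_family pi 'I_q k c N i.
  move=> NS /transversalP[Nk' pi'_inj]; rewrite /c'; case: pickP => [i|no_i].
    by exists i.
  have [//|w|A AN kA||i] := bound_q T W pi k m c N; last by rewrite no_i.
  (* Points of [N] in one original part have distinct residues, so there are at most [q] of them. *)
  - rewrite -[leqRHS]card_ord -(@card_in_imset _ _ (fun x => (pi' x).2)).
      exact: max_card.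
    move=> x y; rewrite !inE => /andP[xN /eqP pix] /andP[yN /eqP piy] xy.
    by apply: pi'_inj => //; apply: (congr2 pair) xy; rewrite pix piy.
  - by apply: color_lt kA; apply: subset_trans NS.
  - by rewrite Nk'.
have [//|[w a]|N NS kN||i] := bound_p T _ pi' k' m c' S.
- rewrite -[leqRHS](prednK p_gt0) -[leqRHS]card_ord.
  rewrite -(@card_in_imset _ _ (fun x => inord (idx x %/ q) : 'I_p.-1.+1)); first exact: max_card.
  have idx_lt x : x \in S -> idx x %/ q < p.-1.+1.
    move=> xS; rewrite prednK // ltn_divLR // mulnC.
    apply: leq_trans (fiber_le (pi x)); rewrite cardE index_mem mem_enum inE xS /=.
    exact: eqxx.
  move=> x y; rewrite !inE => /andP[xS /eqP[pix idx_x]] /andP[yS /eqP[piy idx_y]].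
  move=> /(congr1 (@nat_of_ord _)); rewrite !inordK ?idx_lt // => xy.
  have modq : idx x %% q = idx y %% q.
    by move: (etrans idx_x (esym idx_y)) => /(congr1 (@nat_of_ord _)).

  have : idx x = idx y by rewrite (divn_eq (idx x) q) xy modq -divn_eq.
  have in_fiber z : z \in S -> pi z = w -> z \in enum (fiber w).
    by move=> zS piz; rewrite mem_enum inE zS piz eqxx.
  by rewrite /idx pix piy; apply: (index_inj x); apply: in_fiber.
- by have [i ->] := mono_q N NS kN.
(* The coefficients of [m] add up by p(q-1) + (p-1) = qp - 1. *)
- have pqE : p * q.-1 + p.-1 = (q * p).-1.
    by rewrite -subn1 mulnBr muln1 -[p in RHS]prednK // mulnS -subn1; nia.
  by rewrite /k' /= mulnDr !mulnA (mulnC p q) -addnA -mulnDl pqE.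
move=> /mono_familyP[N colN disN]; exists i.
have mono_N j : mono_family pi 'I_q k c (N j) i.
  have [kN NS cN] := colN j; have [i' ci' mono_i'] := mono_q _ NS kN.
  by rewrite -cN ci'.
suff : mono_family pi ('I_q * 'I_p)%type k c S i.
  by apply: mono_family_card; rewrite card_prod !card_ord.
have family j : {A : {ffun 'I_q -> {set T}} |
    [forall a, [&& transversal pi k (A a), A a \subset N j & c (A a) == i]] &&
    [forall a, forall b, (a != b) ==> [disjoint A a & A b]]}.
  exact/sigW/existsP/mono_N.
apply/mono_familyP; exists (fun u => sval (family u.2) u.1) => [[a j]|[a j] [b j']] /=.
  case: (family j) => A /= /andP[/forallP/(_ a)/and3P[kA AN /eqP cA] _]; split=> //.
  by apply: subset_trans AN _; case: (colN j).
case: (eqVneq j j') => [<-|jj' _].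
  rewrite xpair_eqE eqxx andbT; case: (family j) => A /= /andP[_ disA] ab.
  by move/forallP/(_ a)/forallP/(_ b)/implyP: disA; apply.
case: (family j) (family j') => A /= /andP[/forallP/(_ a)/and3P[_ AN _] _].
case=> B /= /andP[/forallP/(_ b)/and3P[_ BN _] _].
exact: disjointWl AN (disjointWr BN (disN _ _ jj')).
Qed.

Lemma kneser_bound_pos r : 0 < r -> kneser_bound r.
Proof.
elim/ltn_ind: r => r IHr r_gt0.
have [r1|r_gt1] := leqP r 1.
  by have -> : r = 1; [lia | exact: kneser_bound1].
have p_pr := pdiv_prime r_gt1; have p_gt1 := prime_gt1 p_pr.
rewrite -(divnK (pdiv_dvd r)); apply: kneser_bound_mul.
- by rewrite divn_gt0 ?pdiv_gt0 // dvdn_leq ?pdiv_dvd.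
- exact: pdiv_gt0.
- by apply: IHr; [apply: ltn_Pdiv | rewrite divn_gt0 ?pdiv_gt0 // dvdn_leq ?pdiv_dvd].
- exact: kneser_bound_prime.
Qed.

(** * Both bounds for the Kneser hypergraph of a partition *)

Section KneserPartition.
Variables (n k r : nat) (P : {set {set 'I_n}}).
Implicit Types (A B : {set 'I_n}) (E : {set {set 'I_n}}).

Lemma transversal_kg_vertex A : 
  partition P setT -> transversal (pblock P) k A -> kg_vertex k P A.
Proof.
case/and3P=> _ tiP _ /transversalP[kA pi_inj]; rewrite /kg_vertex kA eqxx /=.
apply/forall_inP => B BP; apply/card_le1_eqP => x y /setIP[xA xB] /setIP[yA yB].
by apply: pi_inj => //; rewrite (def_pblock tiP BP xB) (def_pblock tiP BP yB).
Qed.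

Lemma kg_lower_bound m :
    0 < r -> 0 < k -> partition P setT -> (forall B, B \in P -> #|B| <= r) ->
  kg_colorable k r P m -> n <= r * k.-1 + r.-1 * m.
Proof.
move=> r_gt0 k_gt0 partP P_le [c [c_lt c_proper]]; rewrite leqNgt; apply/negP => ltn.
have [covP tiP _] := and3P partP.
have [//|w|A _ kA||i] := kneser_bound_pos r_gt0 (pi := pblock P) (k := k) (m := m)
  (c := c) (S := setT).
- have [wP|wP] := boolP (w \in P).
    apply: leq_trans (P_le w wP); apply/subset_leq_card/subsetP => x.
    by rewrite !inE => /eqP <-; rewrite mem_pblock (eqP covP) inE.
  rewrite (_ : [set _ in _ | _] = set0) ?cards0 //; apply/setP => x; rewrite !inE.
  apply: contraNF wP => /eqP <-; apply: pblock_mem.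
  by rewrite (eqP covP) inE.
- exact/c_lt/transversal_kg_vertex.
- by rewrite cardsT card_ord.
move=> /mono_familyP[A colA disA].
apply: (c_proper (A @: setT)); last first.
  by exists i => _ /imsetP[j _ ->]; case: (colA j).
apply/and3P; split.
(* Disjoint vertices are distinct because [k > 0] makes them nonempty; hence the edge really has [r]
   elements. *)
- rewrite card_imset ?cardsT ?card_ord // => j j' eqA.
  apply/eqP; apply: contraT => /disA; rewrite eqA -setI_eq0 setIid => /eqP A0.
  by have [/transversalP[kA _] _ _] := colA j'; rewrite -kA A0 cards0 in k_gt0.
- apply/forall_inP => _ /imsetP[j _ ->].
  by apply: transversal_kg_vertex => //; case: (colA j).
- apply/forall_inP => _ /imsetP[j _ ->]; apply/forall_inP => _ /imsetP[j' _ ->].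
  by apply/implyP => neqA; apply: disA; apply: contraNneq neqA => ->.
Qed.

Definition min_elt A : nat :=
  if [pick x in A] is Some x then val [arg min_(y < x in A) val y] else 0.

Lemma min_eltP A :
  0 < #|A| -> (exists2 x, x \in A & val x = min_elt A) /\
              (forall x, x \in A -> min_elt A <= x).
Proof.
case/card_gt0P=> x0 x0A; rewrite /min_elt; case: pickP => [x xA|/(_ x0)]; last by rewrite x0A.
by case: arg_minnP => // y yA y_min; split=> //; exists y.
Qed.

Lemma kg_upper_bound m :
  1 < r -> 0 < k -> 0 < m -> n <= r * k.-1 + r.-1 * m -> kg_colorable k r P m.
Proof.
move=> r_gt1 k_gt0 m_gt0 le_n.
exists (fun A => minn (min_elt A %/ r.-1) m.-1); split=> [A _|E].
  by rewrite gtn_min ltn_predL m_gt0 orbT.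
case/and3P=> /eqP Er /forall_inP vtxE /forall_inP disE [i colE].
have r1_gt0 : 0 < r.-1 by lia.
have E_gt0 A : A \in E -> 0 < #|A| by move=> /vtxE/andP[/eqP->].
have tiE : trivIset E.
  by apply/trivIsetP => A B AE BE; move/forall_inP: (disE A AE) => /(_ B BE)/implyP.
have [i_lt|i_ge] := ltnP i m.-1.
  (* Disjoint sets have distinct minima, but a block below the last color holds only r - 1
     integers. *)
  have : #|E| <= r.-1.-1.+1.
    rewrite -[leqRHS]card_ord.
    rewrite -(@card_in_imset _ _ (fun A => inord (min_elt A %% r.-1) : 'I_r.-1.-1.+1)).
      exact: max_card.
    move=> A B AE BE /(congr1 (@nat_of_ord _)); rewrite !inordK ?prednK ?ltn_pmod // => AB.
    have minAB : min_elt A = min_elt B.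
      have div_i B' : B' \in E -> min_elt B' %/ r.-1 = i.
        move/colE; move: (min_elt B' %/ _) i_lt => d /=; lia.
      by rewrite (divn_eq (min_elt A) r.-1) (divn_eq (min_elt B) r.-1) AB !div_i.
    have [[x xA xmin] _] := min_eltP (E_gt0 A AE).
    have [[y yB ymin] _] := min_eltP (E_gt0 B BE).
    have xy : x = y by apply: val_inj; rewrite xmin ymin.
    by rewrite -(def_pblock tiE AE xA) -(def_pblock tiE BE yB) xy.
  by rewrite Er prednK //; lia.
have card_cover : #|cover E| = r * k.
  rewrite -(eqP tiE) -Er -sum_nat_const; apply: eq_bigr => A /vtxE/andP[/eqP->].
  by [].
(* The last color avoids the first (r-1)(m-1) integers, leaving at most r(k-1) + (r-1) = rk - 1
   points, too few for [r] disjoint k-sets. *)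
have : #|cover E| <= n - r.-1 * m.-1.
  rewrite cardE -(size_map val) -(size_iota (r.-1 * m.-1) (n - _)).
  apply: uniq_leq_size; first by rewrite map_inj_uniq ?enum_uniq //; apply: val_inj.
  move=> _ /mapP[x x_E ->]; move: x_E; rewrite mem_enum mem_iota => /bigcupP[A AE xA].
  have [_ /(_ x xA) minx] := min_eltP (E_gt0 A AE).
  have : m.-1 <= min_elt A %/ r.-1 by have := colE A AE; lia.
  rewrite leq_divRL // mulnC => le_min; have := ltn_ord x.
  by rewrite (leq_trans le_min minx) /=; lia.
rewrite card_cover; nia.
Qed.

End KneserPartition.

Theorem theorem1 (n k r : nat) (P : {set {set 'I_n}}) :
  2 <= r -> 1 <= k -> r * k <= n ->
  partition P [set: 'I_n] ->
  (forall B, B \in P -> #|B| <= r) ->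
  is_chromatic_number k r P (ceil_div (n - r * (k - 1)) (r - 1)).
Proof.
move=> r_gt1 k_gt0 le_rk partP P_le; rewrite /ceil_div !subn1.
have r1_gt0 : 0 < r.-1 by lia.
split=> [|m /kg_lower_bound le_n].
  set a := _ + _; have := ltn_ceil a r1_gt0; rewrite {}/a => lt_ceil.
  apply: kg_upper_bound => //; last by lia.
  (* At least one color is available, since n >= rk makes n - r(k-1) positive. *)
  by rewrite divn_gt0 //; nia.
rewrite -ltnS ltn_divLR //; have := le_n (ltnW r_gt1) k_gt0 partP P_le; lia.
Qed.
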